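(* Let $\mathcal C=\mathrm{Cyc}(K,R)$ be a cyclotomic scheme over a finite local commutative ring $R$ other than a field, $K\le R^\times$. Then $\mathrm{Aut}(\mathcal C)\le\mathrm{AGL}_1(R)$ whenever one of the following holds: (1) $K\le\mathcal T$; (2) $K$ is a strongly pure subgroup of $\mathcal U$; (3) $K$ is strongly pure and the residue field of $R$ has prime order.
   Context: All rings have an identity. For a finite local commutative ring $R$ with maximal ideal $\mathrm{rad}(R)$ and residue field of order $q$: $\mathcal T$ is the cyclic subgroup of $R^\times$ of order $q-1$, $\mathcal U=1+\mathrm{rad}(R)$, and $R^\times=\mathcal T\times\mathcal U$. $\mathrm{Cyc}(K,R)$ is the pair $(R,\mathrm{Rel}(K,R))$ with $\mathrm{Rel}(K,R)$ the relations $\{(x,y): y-x\in rK\}$, $r\in R$; $\mathrm{Aut}(\mathcal C)$ is the group of permutations of $R$ fixing each such relation. $\mathrm{AGL}_1(R)$ is the group of permutations $x\mapsto ax+b$, $a\in R^\times$, $b\in R$. $K$ is pure if the only ideal $I$ with $1+I\subseteq K$ is $\{0\}$. With $I_0=\{x\in\mathrm{rad}(R):x\,\mathrm{rad}(R)=\{0\}\}$ and $\pi_0:R\to R/I_0$, $K$ is strongly pure if it is pure and, unless $R$ is a field, $\pi_0(K)$ is a strongly pure subgroup of $(R/I_0)^\times$ (recursive definition). *)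

(* Defs.v *)
From HB Require Import structures.
From mathcomp Require Import all_boot all_order all_algebra all_fingroup all_solvable.
Set Implicit Arguments. Unset Strict Implicit. Unset Printing Implicit Defensive.
Import GRing.Theory.
Local Open Scope ring_scope.

Section Defs.
Variable R : finComUnitRingType.

(* R is local: the non-units form an ideal (closure under addition suffices
   in a commutative ring; closure under multiplication by R is automatic). *)
Definition local_ring : Prop :=
  forall x y : R, x \isn't a GRing.unit -> y \isn't a GRing.unit ->
                  x + y \isn't a GRing.unit.

(* maximal ideal rad(R) of a finite local ring = the set of non-units *)
Definition rad : {set R} := [set x : R | x \isn't a GRing.unit].

Definition is_field : Prop := forall x : R, x != 0 -> x \is a GRing.unit.

Definition is_ideal (I : {set R}) : Prop :=
  [/\ 0 \in I, (forall x y, x \in I -> y \in I -> x + y \in I)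
    & (forall r x, x \in I -> r * x \in I)].

(* order q of the residue field R / rad(R) *)
Definition resq : nat := (#|R| %/ #|rad|)%N.

Definition I0 : {set R} := [set x in rad | [forall y in rad, x * y == 0]].

Definition pure (K : {set R}) : Prop :=
  forall I : {set R}, is_ideal I -> (forall i, i \in I -> 1 + i \in K) ->
    I = [set 0].

Definition Uset : {set {unit R}} := [set u : {unit R} | val u - 1 \in rad].

Definition unitval (K : {set {unit R}}) : {set R} := [set val u | u in K].

(* Cyclotomic relation R_r = {(x,y) : y - x ∈ rK} *)
Definition rK (K : {set {unit R}}) (r : R) : {set R} := [set r * val k | k in K].

Definition AutCyc (K : {set {unit R}}) : {set {perm R}} :=
  [set s : {perm R} | [forall r, forall x, forall y,
     (y - x \in rK K r) == (s y - s x \in rK K r)]].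

Definition AGL1 : {set {perm R}} :=
  [set s : {perm R} | [exists a : {unit R}, exists b : R,
     [forall x, s x == val a * x + b]]].
End Defs.

(* Strongly pure (recursive definition): the quotient R/I_0 is represented
   (up to isomorphism) by a surjective ring morphism f : R -> S with kernel I_0. *)
Inductive strongly_pure : forall R : finComUnitRingType, {set R} -> Prop :=
| SP_field (R : finComUnitRingType) (K : {set R}) :
    is_field R -> pure K -> strongly_pure K
| SP_step (R : finComUnitRingType) (K : {set R})
    (S : finComUnitRingType) (f : {rmorphism R -> S}) :
    ~ is_field R -> pure K ->
    (forall y : S, exists x : R, f x = y) ->
    (forall x : R, (f x == 0) = (x \in I0 R)) ->
    strongly_pure [set f x | x in K] -> strongly_pure K.

(* Main.v *)
(* After composing with an element of AGL_1(R), an automorphism s satisfies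
   s 0 = 0, s 1 = 1 and s y - s x \in (y - x) K for all x, y; one shows s = id.
   If K meets 1 + rad R trivially, then differences of distinct elements of K
   are units, and comparing the values at 0, 1 and a nonzero radical element
   suffices. This covers K <= T; it also covers a prime residue field, where
   the powers of 1 + w, w \in I0, fill 1 + R w, so that strong purity forces
   K to meet 1 + rad R trivially.
   For K <= U, induction along R -> R / I0 makes d x = s x - x a map into I0
   whose slopes (d y - d x) / (y - x) at unit distance lie in the subgroup
   V = {v \in I0 | 1 + v \in K}, and V contains no nonzero ideal. Such a d is
   constant modulo rad R. It is affine: differencing lowers any nonaffine d
   to one all of whose differences are affine, which by symmetry of the mixed
   difference is additive up to a constant; and the additive ones are linear
   because the operator d |-> d x - t^-1 d (t x), t a generator of the residual
   multiplicative group, followed by division by 1 - t, preserves the slopes. *)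
Require Import Defs.
From HB Require Import structures.
From mathcomp Require Import all_boot all_order all_algebra all_fingroup all_solvable.
From mathcomp Require Import ring.
Set Implicit Arguments. Unset Strict Implicit. Unset Printing Implicit Defensive.
Import GRing.Theory.
Import Defs.
Local Open Scope ring_scope.

(** Derives an equation from another one with the same difference of sides; that coincidence is an
    identity for [ring]. *)
Lemma eq_by_sub (V : zmodType) (a b c d : V) : c = d -> a - b = c - d -> a = b.
Proof. by move=> ->; rewrite subrr => /eqP; rewrite subr_eq0 => /eqP. Qed.

Lemma unit_exp_eq1 (R : finUnitRingType) (u : R) : u \is a GRing.unit ->
  exists2 n : nat, (0 < n)%N & u ^+ n = 1.
Proof.
move=> Uu; exists #|[set: {unit R}]|; first exact: cardG_gt0.
have := expg_cardG (in_setT (FinRing.unit R Uu)).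
by move/(congr1 val); rewrite FinRing.val_unitX.
Qed.

Lemma card_mulrn0 (V : finZmodType) (x : V) : x *+ #|V| = 0.
Proof. by rewrite -FinRing.zmodXgE -cardsT expg_cardG ?inE. Qed.

(** * The radical of a local ring and the ideal [I0] that it annihilates *)

Section LocalRing.
Variable R : finComUnitRingType.
Hypothesis locR : local_ring R.
Implicit Types x y u v w r j : R.

Lemma radE x : (x \in rad R) = (x \isn't a GRing.unit).
Proof. by rewrite inE. Qed.

Lemma radM r x : x \in rad R -> r * x \in rad R.
Proof. by rewrite !radE unitrM negb_and => ->; rewrite orbT. Qed.

Lemma radMr r x : x \in rad R -> x * r \in rad R.
Proof. by rewrite mulrC; apply: radM. Qed.

Lemma radN x : x \in rad R -> - x \in rad R.
Proof. by rewrite !radE unitrN. Qed.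

Lemma radD x y : x \in rad R -> y \in rad R -> x + y \in rad R.
Proof. by rewrite !radE; apply: locR. Qed.

Lemma radB x y : x \in rad R -> y \in rad R -> x - y \in rad R.
Proof. by move=> xr yr; apply/radD/radN. Qed.

Lemma rad0 : 0 \in rad R.
Proof. by rewrite radE unitr0. Qed.

Lemma unitDrad u j : u \is a GRing.unit -> j \in rad R -> u + j \is a GRing.unit.
Proof.
move=> Uu jr; apply: contraLR Uu; rewrite -!radE => ujr.
by rewrite -(addrK j u) radB.
Qed.

Lemma rad_exp_sub x y n : x - y \in rad R -> x ^+ n - y ^+ n \in rad R.
Proof.
move=> xy; elim: n => [|n IH]; first by rewrite subrr rad0.
have -> : x ^+ n.+1 - y ^+ n.+1 = x * (x ^+ n - y ^+ n) + (x - y) * y ^+ n.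
  by rewrite !exprS; ring.
by apply: radD; [apply: radM | apply: radMr].
Qed.

Lemma I0P w : reflect (w \in rad R /\ forall j, j \in rad R -> j * w = 0)
                      (w \in I0 R).
Proof.
apply: (iffP setIdP) => -[wr wI]; split=> //.
  by move=> j jr; have /forallP/(_ j) := wI; rewrite jr mulrC => /eqP.
by apply/forallP=> j; apply/implyP=> /wI; rewrite mulrC => ->.
Qed.

Lemma I0_rad w : w \in I0 R -> w \in rad R.
Proof. by case/I0P. Qed.

Lemma rad_I0 j w : j \in rad R -> w \in I0 R -> j * w = 0.
Proof. by move=> jr /I0P[_]; apply. Qed.

Lemma I00 : 0 \in I0 R.
Proof. by apply/I0P; split=> [|j _]; rewrite ?rad0 ?mulr0. Qed.

Lemma I0M r w : w \in I0 R -> r * w \in I0 R.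
Proof.
case/I0P=> wr wI; apply/I0P; split=> [|j /wI jw]; first exact: radM.
by rewrite mulrCA jw mulr0.
Qed.

Lemma I0B v w : v \in I0 R -> w \in I0 R -> v - w \in I0 R.
Proof.
case/I0P=> vr vI /I0P[wr wI]; apply/I0P; split=> [|j jr]; first exact: radB.
by rewrite mulrBr vI ?wI ?subrr.
Qed.

(** [I0 R] is a vector space over the residue field: scalars count only modulo the radical. *)
Lemma eq_mul_I0 x y w : x - y \in rad R -> w \in I0 R -> x * w = y * w.
Proof. by move=> xy wI; apply/eqP; rewrite -subr_eq0 -mulrBl rad_I0. Qed.

(** A product of units is a unit, so one of the prime factors of [n] must lie in the radical; it is
    the residue characteristic. *)
Lemma prime_in_rad n : (0 < n)%N -> n%:R \in rad R ->
  exists2 p, prime p & p%:R \in rad R.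
Proof.
elim/ltn_ind: n => n IH n_gt0 nr.
have n_gt1: (1 < n)%N.
  by case: n n_gt0 nr {IH} => [|[|]] // _; rewrite radE unitr1.
have pp := pdiv_prime n_gt1.
case: (boolP ((pdiv n)%:R \in rad R)) => [|pu]; first by exists (pdiv n).
have /dvdnP[k def_n] := pdiv_dvd n.
have k_gt0 : (0 < k)%N by case: k def_n n_gt0 => // ->; rewrite mul0n.
apply: (IH k) => //; first by rewrite def_n ltn_Pmulr ?prime_gt1.
move: nr pu; rewrite !radE negbK {1}def_n natrM unitrM => /[swap] ->.
by rewrite andbT.
Qed.

Lemma pred_unit m : m.+1%:R \in rad R -> m%:R \is a @GRing.unit R.
Proof.
move=> mr; have := unitDrad (unitrN1 R) mr.
by rewrite -natr1 addrC addrK.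
Qed.

(** Asked of arbitrary maps rather than permutations, so that it passes to quotients with no
    bijectivity to check. *)
Definition cyc_map (K : {set R}) (s : R -> R) :=
  forall x y, exists2 k, k \in K & s y - s x = (y - x) * k.

Lemma cyc_map_id_inj (K : {set R}) s : ~ is_field R -> 1 \in K ->
    {in K &, forall k k', k - k' \in rad R -> k = k'} ->
  s 0 = 0 -> s 1 = 1 -> cyc_map K s -> forall x, s x = x.
Proof.
move=> nfR K1 injK s0 s1 sK.
have s_mul x : exists2 k, k \in K & s x = x * k.
  by have [k Kk] := sK 0 x; rewrite s0 !subr0; exists k.
have fix_rad x : x \in rad R -> s x = x.
  move=> xr; have [k Kk sx] := s_mul x; have [k' Kk'] := sK 1 x.
  rewrite s1 sx => e1.
  (* Comparing the slopes from 0 and from 1 puts [1 - k'] in the radical, so [k' = 1] and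
     [x * (k - 1) = 0]. *)
  have e2 : 1 - k' = x * (k - k').
    by apply: (eq_by_sub (esym e1)); ring.
  have k'1: 1 = k' by apply: injK => //; rewrite e2 radMr.
  move: e2; rewrite -k'1 subrr => /esym.
  have [/(injK _ _ Kk K1)-> | ] := boolP (k - 1 \in rad R); first by rewrite mulr1.
  rewrite radE negbK => Uk xk0.
  have -> : x = 0 by apply: (mulIr Uk); rewrite xk0 mul0r.
  by rewrite mul0r.
move=> x; have [/fix_rad // | ] := boolP (x \in rad R).
rewrite radE negbK => Ux.
have [y yr y0]: exists2 y, y \in rad R & y != 0.
  have [/existsP[y /andP[]] | ] := boolP [exists y, (y \in rad R) && (y != 0)].
    by exists y.
  rewrite negb_exists => /forallP noy; case: nfR => y y0.
  by have := noy y; rewrite y0 andbT radE negbK.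
(* For a unit [x], the slope from the radical point [y], already known to be fixed, replaces the
   slope from 1. *)
have [k Kk sx] := s_mul x; have [k'' Kk''] := sK y x.
rewrite sx (fix_rad y yr) => e2.
have e3 : x * (k - k'') = y * (1 - k'') by apply: (eq_by_sub e2); ring.
have kk: k = k''.
  apply: injK => //; have := radMr (1 - k'') yr; rewrite -e3.
  by move/(radM x^-1); rewrite mulKr.
have : y * (1 - k'') = 0 by rewrite -e3 kk subrr mulr0.
have [/(injK _ _ K1 Kk'')k1 | ] := boolP (1 - k'' \in rad R).
  by rewrite kk -k1 mulr1.
rewrite radE negbK => Uk yk0; case/eqP: y0.
by apply: (mulIr Uk); rewrite yk0 mul0r.
Qed.

End LocalRing.

(** * Maps into [I0 R] with slopes in a subgroup that contains no nonzero ideal *)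

Section Slopes.
Variables (R : finComUnitRingType) (V : {set R}).
Hypothesis locR : local_ring R.
Hypothesis V0 : 0 \in V.
Hypothesis VB : {in V &, forall v w, v - w \in V}.
Hypothesis V_pure : forall w, (forall r, r * w \in V) -> w = 0.
Implicit Types (d : {ffun R -> R}) (x y u v w r b : R).

Definition slopes_in d :=
  (forall x, d x \in I0 R) /\
  (forall x y, y - x \is a GRing.unit -> (y - x)^-1 * (d y - d x) \in V).

Definition additive d := forall x y, d (x + y) = d x + d y.

Definition affine d := [forall x, d x == d 0 + x * (d 1 - d 0)].

Lemma slopes_inB d e : slopes_in d -> slopes_in e ->
  slopes_in [ffun x => d x - e x].
Proof.
move=> [dI dV] [eI eV]; split=> [x | x y Uxy]; rewrite !ffunE; first exact: I0B.
have -> : d y - e y - (d x - e x) = (d y - d x) - (e y - e x) by ring.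
by rewrite mulrBr VB ?dV ?eV.
Qed.

Lemma slopes_in_shift b d : slopes_in d -> slopes_in [ffun x => d (x + b)].
Proof.
move=> [dI dV]; split=> [x | x y]; rewrite !ffunE ?dI //.
have -> : y - x = (y + b) - (x + b) by ring.
exact: dV.
Qed.

Lemma slopes_in_dilate u d : u \is a GRing.unit -> slopes_in d ->
  slopes_in [ffun x => u^-1 * d (u * x)].
Proof.
move=> Uu [dI dV]; split=> [x | x y Uxy]; rewrite !ffunE; first exact/I0M/dI.
rewrite -mulrBr mulrA -invrM // (mulrBr u); apply: dV.
by rewrite -mulrBr unitrM Uu.
Qed.

(* The slopes towards a third point z make (d y - d x) / u lie in V for every
   unit u, hence r * (d y - d x) lie in V for every r. *)
Lemma slopes_in_rad d x y : slopes_in d -> y - x \in rad R -> d y = d x.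
Proof.
move=> [dI dV] xy; apply/eqP; rewrite -subr_eq0; apply/eqP.
have wI : d y - d x \in I0 R by rewrite I0B.
apply: V_pure => r; have [rr | ] := boolP (r \in rad R); first by rewrite rad_I0.
rewrite radE negbK => Ur; pose z := x - r^-1.
have xz : x - z = r^-1 by rewrite /z; ring.
have yz : y - z = r^-1 + (y - x) by rewrite /z; ring.
have Uyz : y - z \is a GRing.unit by rewrite yz unitDrad ?unitrV.
have := dV _ _ Uyz; have := dV z x; rewrite xz invrK unitrV => /(_ Ur) Vx Vy.
suff -> : r * (d y - d x) = (y - z)^-1 * (d y - d z) - r * (d x - d z) by apply: VB.
have WI : d y - d z \in I0 R by rewrite I0B.
have -> : (y - z)^-1 * (d y - d z) = r * (d y - d z); last by ring.
apply: (mulrI Uyz); rewrite mulVKr // mulrCA (@eq_mul_I0 _ (y - z) r^-1) ?mulVKr //.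
by rewrite yz addrC addKr.
Qed.

Lemma additive0 d : additive d -> d 0 = 0.
Proof. by move=> dD; apply: (addrI (d 0)); rewrite -dD !addr0. Qed.

Lemma additiveB d x y : additive d -> d (x - y) = d x - d y.
Proof. by move=> dD; apply: (addIr (d y)); rewrite -dD !subrK. Qed.

Definition add_slopes d := slopes_in d /\ additive d.

Lemma add_slopesP d :
  (forall x, d x \in I0 R) -> additive d ->
  (forall x, x \is a GRing.unit -> x^-1 * d x \in V) -> add_slopes d.
Proof.
move=> dI dD dV; split=> //; split=> // x y Uxy.
by rewrite -additiveB //; apply: dV.
Qed.

Lemma add_slopesV d x : add_slopes d -> x \is a GRing.unit -> x^-1 * d x \in V.
Proof.
by case=> [[_ dV] dD] Ux; have := dV 0 x; rewrite subr0 additive0 ?subr0 //; apply.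
Qed.

Lemma add_slopes_dilate u d : u \is a GRing.unit -> add_slopes d ->
  add_slopes [ffun x => u^-1 * d (u * x)].
Proof.
move=> Uu [dV dD]; split; first exact: slopes_in_dilate.
by move=> x y; rewrite !ffunE mulrDr dD mulrDr.
Qed.

Lemma add_slopesB d e : add_slopes d -> add_slopes e ->
  add_slopes [ffun x => d x - e x].
Proof.
move=> [dV dD] [eV eD]; split; first exact: slopes_inB.
by move=> x y; rewrite !ffunE dD eD; ring.
Qed.

Definition scale r d : {ffun R -> R} := [ffun x => r * d x].

(** For a unit [u], the obstruction to [d] commuting with multiplication by [u]. *)
Definition twist u d : {ffun R -> R} := [ffun x => d x - u^-1 * d (u * x)].

Lemma twist_scale u r d : twist u (scale r d) = scale r (twist u d).
Proof. by apply/ffunP=> x; rewrite !ffunE; ring. Qed.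

Lemma scale_scale r r' d : scale r (scale r' d) = scale (r * r') d.
Proof. by apply/ffunP=> x; rewrite !ffunE mulrA. Qed.

Lemma add_slopes_twist u d : u \is a GRing.unit -> add_slopes d ->
  add_slopes (twist u d).
Proof.
move=> Uu dA; have := add_slopesB dA (add_slopes_dilate Uu dA).
by congr add_slopes; apply/ffunP=> x; rewrite !ffunE.
Qed.

(* With g, h, k the slopes of d from 0 to x, u x and (1 - u) x, additivity
   reads (1 - u) k = g - u h, so that k - h = (g - h) / (1 - u). *)
Lemma add_slopes_scale_twist u d :
  u \is a GRing.unit -> 1 - u \is a GRing.unit -> add_slopes d ->
  add_slopes (scale (1 - u)^-1 (twist u d)).
Proof.
move=> Uu U1u dA; have [[dI _] dD] := add_slopes_twist Uu dA.
apply: add_slopesP => [x | x y | x Ux]; first by rewrite ffunE I0M.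
  by rewrite 3![scale _ _ _]ffunE dD mulrDr.
rewrite !ffunE; set g := d x; set h := d (u * x).
have Vk : ((1 - u) * x)^-1 * (g - h) \in V.
  have <- : d ((1 - u) * x) = g - h by rewrite mulrBl mul1r additiveB //; case: dA.
  by apply: add_slopesV; rewrite ?unitrM ?U1u.
have Vh : (u * x)^-1 * h \in V by apply: add_slopesV; rewrite ?unitrM ?Uu.
have -> : x^-1 * ((1 - u)^-1 * (g - u^-1 * h)) =
    ((1 - u) * x)^-1 * (g - h) - (u * x)^-1 * h.
  rewrite !invrM //; apply/eqP; rewrite -subr_eq0; apply/eqP.
  transitivity (x^-1 * h * (u^-1 * (1 - (1 - u) * (1 - u)^-1) +
                            (1 - u)^-1 * (1 - u * u^-1))); first by ring.
  by rewrite !mulrV // subrr !mulr0 addr0 mulr0.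
exact: VB.
Qed.

(** * Linearity of additive maps, through a generator of the residual unit group *)

Variables (t : R) (m : nat).
Hypothesis Ut : t \is a GRing.unit.
Hypothesis t_gen : forall u, u \is a GRing.unit -> exists i, u - t ^+ i \in rad R.
Hypothesis t_order : t ^+ m - 1 \in rad R.
Hypothesis m_char : m.+1%:R \in rad R.

Lemma add_slopes_iter n d : add_slopes d -> add_slopes (iter n (twist t) d).
Proof. by elim: n => //= n IH /IH; apply: add_slopes_twist. Qed.

(** Each of the [n] twists can absorb one factor [(1 - t)^-1], whence the bound on [i]. *)
Lemma add_slopes_scale_iter i n d : 1 - t \is a GRing.unit -> (i <= n)%N ->
  add_slopes d -> add_slopes (scale ((1 - t)^-1 ^+ i) (iter n (twist t) d)).
Proof.
move=> U1t + dA; elim: i n => [|i IH] [|n] // in_.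
- by rewrite expr0 /scale (_ : [ffun x => _] = d) //; apply/ffunP=> x; rewrite !ffunE mul1r.
- rewrite expr0; have := add_slopes_iter n.+1 dA; congr add_slopes.
  by apply/ffunP=> x; rewrite [in RHS]ffunE mul1r.
rewrite exprS -scale_scale /= -twist_scale.
by apply: add_slopes_scale_twist => //; apply: IH.
Qed.

(* A periodic d of twist t is invariant under (1 - t)^-1, by the factor gained
   in each application of twist t, so that R d consists of maps with slopes in V. *)
Lemma periodic_twist_eq0 d e : 1 - t \is a GRing.unit -> (0 < e)%N ->
  add_slopes d -> iter e (twist t) d = d -> forall x, d x = 0.
Proof.
move=> U1t e_gt0 dA d_per.
have d_iter i : iter (i * e) (twist t) d = d.
  by elim: i => // i IH; rewrite mulSn iterD IH.
have dc i : add_slopes (scale ((1 - t)^-1 ^+ i) d).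
  by rewrite -{1}(d_iter i); apply: add_slopes_scale_iter => //; apply: leq_pmulr.
have [n n_gt0 cn] : exists2 n, (0 < n)%N & (1 - t)^-1 ^+ n = 1.
  by apply: unit_exp_eq1; rewrite unitrV.
(* Having finite order, [1 - t] is itself a power of its inverse. *)
have d1t j : add_slopes (scale ((1 - t) ^+ j) d).
  have -> : 1 - t = (1 - t)^-1 ^+ n.-1; last by rewrite -exprM.
  by apply: (mulrI (x := (1 - t)^-1)); rewrite ?unitrV // mulVr // -exprS prednK.
(* Since [t = 1 - (1 - t)], powers of [t] may be inserted too, and these represent all units modulo
   the radical. *)
have dt i j : add_slopes (scale (t ^+ i * (1 - t) ^+ j) d).
  elim: i j => [|i IH] j; first by rewrite mul1r.
  have := add_slopesB (IH j) (IH j.+1); congr add_slopes; apply/ffunP=> x.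
  by rewrite !ffunE !exprS; ring.
have [[dI _] dD] := dA.
have d_unit x : x \is a GRing.unit -> d x = 0.
  move=> Ux; rewrite -(mulVKr Ux (d x)); suff -> : x^-1 * d x = 0 by rewrite mulr0.
  apply: V_pure => r; have [rr | ] := boolP (r \in rad R).
    by rewrite rad_I0 // I0M.
  rewrite radE negbK => /t_gen[i ri]; rewrite (eq_mul_I0 ri) ?I0M // mulrCA.
  by have := add_slopesV (dt i 0%N) Ux; rewrite ffunE expr0 mulr1.
move=> x; have [xr | ] := boolP (x \in rad R); last by rewrite radE negbK; apply: d_unit.
by rewrite (@slopes_in_rad _ 0 x) ?subr0 ?additive0 //; case: dA.
Qed.

(** By finiteness the iterates of [d] become periodic, and periodic ones vanish. *)
Lemma twist_nilpotent d : 1 - t \is a GRing.unit -> add_slopes d ->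
  exists k, forall x, iter k (twist t) d x = 0.
Proof.
move=> U1t dA; set T := twist t.
have /trajectP[k k_lt dk] := looping_order T d; exists k.
apply: (@periodic_twist_eq0 _ (fingraph.order T d - k)) => //.
- by rewrite subn_gt0.
- exact: add_slopes_iter.
by rewrite -iterD subnK // ltnW.
Qed.

(* Semisimplicity: the order m of dilation by t is prime to the characteristic. *)
Lemma twist_twist_eq0 d : add_slopes d ->
  (forall x, twist t (twist t d) x = 0) -> forall x, twist t d x = 0.
Proof.
move=> dA TTd x; set e := twist t d.
have eA : add_slopes e by apply: add_slopes_twist.
have et i : e (t ^+ i * x) = t ^+ i * e x.
  elim: i => [|i IH]; first by rewrite !mul1r.
  have := TTd (t ^+ i * x); rewrite -/e ffunE => /eqP; rewrite subr_eq0 => /eqP e1.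
  by rewrite exprS -!mulrA -IH e1 mulVKr.
(* The defect [e] accumulates linearly in [i]; at [i = m], where [t ^+ i] is 1 modulo the radical,
   it gives [m%:R * e x = 0]. *)
have dt i : d (t ^+ i * x) = t ^+ i * (d x - e x *+ i).
  elim: i => [|i IH]; first by rewrite !mul1r mulr0n subr0.
  have := et i; rewrite {1}/e ffunE IH mulrA -exprS => e1.
  apply: (mulrI (x := t^-1)); rewrite ?unitrV // exprS -[in RHS]mulrA mulKr //.
  by rewrite -exprS; apply: (eq_by_sub (esym e1)); rewrite mulrSr; ring.
have [[dI _] _] := dA; have [[eI _] _] := eA.
have := dt m; rewrite (@slopes_in_rad d x); first last.
- by rewrite -{2}(mul1r x) -mulrBl radMr.
- by case: dA.
rewrite (@eq_mul_I0 _ _ 1) ?mul1r; first last.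
- by rewrite I0B // -mulr_natl I0M.
- by [].
move=> dm; have me : m%:R * e x = 0 by apply: (eq_by_sub dm); rewrite mulr_natl; ring.
by apply: (mulrI (pred_unit locR m_char)); rewrite me mulr0.
Qed.

Lemma add_slopes_linear d : add_slopes d -> forall x, d x = x * d 1.
Proof.
move=> dA; have [dV dD] := dA.
have dt x : d (t * x) = t * d x.
  (* Here the residue field has two elements, and constancy modulo the radical suffices. *)
  have [tr | ] := boolP (1 - t \in rad R).
    have tr' : t - 1 \in rad R by rewrite -opprB radN.
    rewrite (@slopes_in_rad d x) //; last by rewrite -{2}(mul1r x) -mulrBl radMr.
    by rewrite (eq_mul_I0 tr') ?mul1r //; case: dV.
  rewrite radE negbK => U1t; have [k] := twist_nilpotent U1t dA.
  suff Td0 : (forall x, iter k (twist t) d x = 0) -> forall x, twist t d x = 0.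
    move/Td0/(_ x); rewrite ffunE => /eqP; rewrite subr_eq0 => /eqP ->.
    by rewrite mulVKr.
  (* The induction hypothesis for [twist t d] kills the double twist, hence by semisimplicity the
     single one. *)
  elim: k d {dV dD} dA => [|k IH] d dA d0 y.
    by rewrite ffunE !d0 mulr0 subr0.
  apply: twist_twist_eq0 => //; apply: IH; first exact: add_slopes_twist.
  by move=> z; rewrite -iterSr.
have dti i : d (t ^+ i) = t ^+ i * d 1.
  by elim: i => [|i IH]; rewrite ?mul1r // exprS dt IH mulrA.
move=> x; have dI : d 1 \in I0 R by case: dV.
have [xr | ] := boolP (x \in rad R).
  by rewrite (@slopes_in_rad d 0 x) ?subr0 // additive0 // rad_I0.
rewrite radE negbK => /t_gen[i xi].
by rewrite (slopes_in_rad dV xi) dti (eq_mul_I0 xi).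
Qed.

(** * Finite differences, and affinity of all maps with slopes in [V] *)

Definition diff b d : {ffun R -> R} := [ffun x => d (x + b) - d x].

Lemma diffC b c d : diff b (diff c d) = diff c (diff b d).
Proof. by apply/ffunP=> x; rewrite !ffunE (addrAC x); ring. Qed.

Lemma slopes_in_diff b d : slopes_in d -> slopes_in (diff b d).
Proof.
move=> dV; have := slopes_inB (slopes_in_shift b dV) dV.
by congr slopes_in; apply/ffunP=> x; rewrite !ffunE.
Qed.

Lemma affineP d : reflect (forall x, d x = d 0 + x * (d 1 - d 0)) (affine d).
Proof. exact: eqfunP. Qed.

Lemma affine_diff b d : affine d -> affine (diff b d).
Proof.
move/affineP=> dA; apply/affineP=> x; rewrite !ffunE.
by rewrite (dA (x + b)) (dA x) (dA (0 + b)) (dA (1 + b)); ring.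
Qed.

(** Newton's forward difference formula, from Pascal's rule. *)
Lemma newton_diff b d k x :
  d (x + b *+ k) = \sum_(i < k.+1) iter i (diff b) d x *+ 'C(k, i).
Proof.
elim: k d x => [|k IH] d x; first by rewrite big_ord1 mulr0n addr0.
have -> : d (x + b *+ k.+1) = d (x + b *+ k) + diff b d (x + b *+ k).
  by rewrite ffunE [RHS]addrC subrK mulrSr addrA.
rewrite !IH [RHS]big_ord_recl /= bin0 big_ord_recl /= bin0 -addrA; congr (_ + _).
under [in RHS]eq_bigr => i _ do rewrite binS mulrnDr.
rewrite big_split /= [in RHS]big_ord_recr /= bin_small // mulr0n addr0; congr (_ + _).
by apply: eq_bigr => i _; rewrite -iterSr.
Qed.

(** In Newton's formula for [d (x + b *+ p)], the left side is [d x] because [b *+ p] is radical,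
    and the inner binomials are multiples of [p], which annihilates [I0 R]; only the [p]-th
    difference remains. *)
Lemma iter_diff_char p b d x : prime p -> p%:R \in rad R -> slopes_in d ->
  iter p (diff b) d x = 0.
Proof.
move=> pp pr dV; have := newton_diff b d p x.
rewrite (@slopes_in_rad d x) //; last first.
  by rewrite addrC addKr -mulr_natl radMr.
case: p pp pr => // p pp pr.
rewrite big_ord_recl /= bin0 big_ord_recr /= binn !mulr1n big1 ?add0r => [dp|i _].
  by apply: (eq_by_sub (esym dp)); ring.
have /dvdnP[c ->] : (p.+1 %| 'C(p.+1, bump 0 i))%N by rewrite prime_dvd_bin // ltnS ltn_ord.
rewrite mulnC mulrnA -[_ *+ p.+1]mulr_natl rad_I0 ?mul0rn //.
have dI j : slopes_in (iter j (diff b) d) by elim: j => //= j; apply: slopes_in_diff.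
by case: (dI (bump 0 i)) => + _; apply.
Qed.

(* The mixed second difference of d is x v(b) = b v(x), so v is linear with
   values in V, and vanishes by purity. *)
Lemma affine_of_diff d : slopes_in d -> (forall b, affine (diff b d)) -> affine d.
Proof.
move=> dV dA; pose v b := d (1 + b) - d 1 - d b + d 0.
have vE x b : d (x + b) = d x + d b - d 0 + x * v b.
  have /affineP/(_ x) := dA b; rewrite !ffunE add0r => e1.
  by apply: (eq_by_sub e1); rewrite /v; ring.
have v_lin b : v b = b * v 1.
  have := vE b 1; rewrite addrC vE mul1r => e1.
  by apply: (eq_by_sub e1); ring.
have v1 : v 1 = 0.
  apply: V_pure => b; rewrite -v_lin; case: (slopes_in_diff b dV) => _ /(_ 0 1).
  rewrite subr0 unitr1 invr1 mul1r !ffunE add0r => /(_ isT).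
  by congr (_ \in V); rewrite /v; ring.
have cV : slopes_in [ffun _ => d 0].
  by split=> [x | x y _]; rewrite !ffunE ?subrr ?mulr0 //; case: dV.
have eA : add_slopes [ffun x => d x - [ffun _ => d 0] x].
  split; first exact: slopes_inB.
  by move=> x y; rewrite !ffunE vE v_lin v1; ring.
apply/affineP=> x; have := add_slopes_linear eA x; rewrite !ffunE => e1.
by apply: (eq_by_sub e1); ring.
Qed.

(** The elements [b] are treated one by one, replacing [e] by the iterate of [diff b] just before
    the first affine one. Differences commute and preserve affinity, so earlier gains persist. *)
Lemma slopes_in_affine d : slopes_in d -> affine d.
Proof.
move=> dV; apply: contraT => dN.
have [p pp pr] := prime_in_rad (ltn0Sn m) m_char.
have iterV k b e : slopes_in e -> slopes_in (iter k (diff b) e).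
  by move=> eV; elim: k => //= k; apply: slopes_in_diff.
have [e [eV eN eA]] : exists e, [/\ slopes_in e, ~~ affine e &
    forall b, b \in enum R -> affine (diff b e)].
  elim: (enum R) => [|b l [e [eV eN eA]]]; first by exists d.
  have : exists k, affine (iter k (diff b) e).
    exists p; apply/affineP=> x.
    by rewrite !(iter_diff_char b _ pp pr eV) subrr mulr0 addr0.
  case/ex_minnP=> -[|k] kA k_min; first by rewrite kA in eN.
  exists (iter k (diff b) e); split; first exact: iterV.
    by apply/negP=> /k_min; rewrite ltnn.
  move=> c; rewrite inE => /predU1P[-> //|/eA cA].
  suff -> : diff c (iter k (diff b) e) = iter k (diff b) (diff c e).
    by elim: (k) => //= j; apply: affine_diff.
  by elim: (k) => //= j IH; rewrite diffC IH.
by rewrite affine_of_diff // in eN => b; rewrite eA ?mem_enum.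
Qed.

End Slopes.

Lemma pure_principal (R : finComUnitRingType) (K : {set R}) w :
  pure K -> (forall r, 1 + r * w \in K) -> w = 0.
Proof.
move=> pK wK; pose I := [set r * w | r in [set: R]].
suff I0 : I = [set 0] by apply/set1P; rewrite -I0; apply/imsetP; exists 1; rewrite ?mul1r.
apply: pK => [|_ /imsetP[r _ ->]]; last exact: wK.
split=> [|_ _ /imsetP[r _ ->] /imsetP[r' _ ->]|r _ /imsetP[r' _ ->]]; apply/imsetP.
- by exists 0; rewrite ?mul0r.
- by exists (r + r'); rewrite ?mulrDl.
- by exists (r * r'); rewrite ?mulrA.
Qed.

(** Phrased on subsets of [R], as [strongly_pure] is, so that it passes directly to images under
    [f]. *)
Definition unit_subgroup (R : finComUnitRingType) (K : {set R}) : Prop :=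
  [/\ 1 \in K, {in K &, forall k k', k * k' \in K} &
      {in K, forall k, k \is a GRing.unit /\ k^-1 \in K}].

(** * Passage to the quotient by [I0 R] *)

Section QuotientI0.
Variables (R S : finComUnitRingType) (f : {rmorphism R -> S}).
Hypothesis locR : local_ring R.
Hypothesis f_surj : forall y, exists x, f x = y.
Hypothesis f_ker : forall x, (f x == 0) = (x \in I0 R).

(** A lift of the inverse of [f x] inverts [x] up to an element of [I0 R], hence of the radical. *)
Lemma quo_unit x : (f x \is a GRing.unit) = (x \is a GRing.unit).
Proof.
apply/idP/idP => [Ufx | Ux]; last exact: rmorph_unit.
have [y fy] := f_surj (f x)^-1.
have : x * y - 1 \in I0 R by rewrite -f_ker rmorphB rmorphM rmorph1 fy mulrV ?subrr.
move/I0_rad => xyr; have : x * y \is a GRing.unit.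
  by rewrite -(subrK 1 (x * y)) addrC unitDrad ?unitr1.
by rewrite unitrM => /andP[].
Qed.

Lemma quo_rad x : (f x \in rad S) = (x \in rad R).
Proof. by rewrite !radE quo_unit. Qed.

Lemma quo_local : local_ring S.
Proof.
move=> y y'; have [x <-] := f_surj y; have [x' <-] := f_surj y'.
by rewrite -rmorphD !quo_unit; apply: locR.
Qed.

Lemma quo_unit_subgroup (K : {set R}) : unit_subgroup K -> unit_subgroup (f @: K).
Proof.
case=> K1 KM KV; split=> [|_ _ /imsetP[k Kk ->] /imsetP[k' Kk' ->]|_ /imsetP[k Kk ->]].
- by rewrite -(rmorph1 f) imset_f.
- by rewrite -rmorphM imset_f ?KM.
- by have [Uk KVk] := KV k Kk; rewrite quo_unit -rmorphV // imset_f.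
Qed.

(** As [s y - s x] is a multiple of [y - x], the map [s] respects congruence modulo the kernel and
    descends through any section [g] of [f]. *)
Lemma quo_cyc_map (K : {set R}) s : cyc_map K s ->
  exists2 s' : S -> S, (forall x, f (s x) = s' (f x)) & cyc_map (f @: K) s'.
Proof.
move=> sK; have f_inv y : exists x, f x == y by have [x <-] := f_surj y; exists x.
pose g y := xchoose (f_inv y).
have fg y : f (g y) = y by apply/eqP/(xchooseP (f_inv y)).
exists (f \o s \o g) => [x | y y'] /=.
  have [k _ e1] := sK x (g (f x)); apply/esym/eqP.
  by rewrite -subr_eq0 -rmorphB e1 rmorphM rmorphB fg subrr mul0r.
have [k Kk e1] := sK (g y) (g y'); exists (f k); first exact: imset_f.
by rewrite -rmorphB e1 rmorphM rmorphB !fg.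
Qed.

End QuotientI0.

Lemma field_rad (R : finComUnitRingType) x : is_field R -> x \in rad R -> x = 0.
Proof. by move=> fR; rewrite radE => xN; apply: contraNeq xN; apply: fR. Qed.

(* The last quotient in the chain defining strong purity is the residue field,
   whose multiplicative group is cyclic. *)
Lemma strongly_pure_residue_gen (R : finComUnitRingType) (K : {set R}) :
    strongly_pure K -> local_ring R ->
  exists t m, [/\ t \is a GRing.unit,
    forall u, u \is a GRing.unit -> exists i, u - t ^+ i \in rad R,
    t ^+ m - 1 \in rad R & m.+1%:R \in rad R].
Proof.
elim=> {R K} [R K fR _ _ | R K S f _ _ f_surj f_ker _ IH locR].
  have /cyclicP[t tG] : cyclic [set: {unit R}].
    apply: (@div_ring_mul_group_cyclic _ [set: {unit R}]%G R (@FinRing.uval R)) => //.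
      move=> u; rewrite inE => /andP[u1 _]; apply: fR; rewrite subr_eq0.
      by apply: contraNneq u1 => u1; rewrite inE; apply/eqP/val_inj.
    by apply/centsP=> u _ v _; apply: val_inj; apply: mulrC.
  exists (val t), #|[set: {unit R}]|; split.
  - exact: valP.
  - move=> u Uu; have : FinRing.unit R Uu \in <[t]>%g by rewrite -tG inE.
    case/cycleP=> i /(congr1 val); rewrite FinRing.val_unitX /= => ->.
    by exists i; rewrite subrr rad0.
  - have := expg_cardG (in_setT t); move/(congr1 val); rewrite FinRing.val_unitX => ->.
    by rewrite subrr rad0.
  suff -> : #|[set: {unit R}]|.+1 = #|R| by rewrite card_mulrn0 rad0.
  rewrite cardsT card_sub [RHS](cardD1 (0 : R)) inE add1n; congr _.+1.
  apply: eq_card => x; rewrite !inE andbT.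
  by apply/idP/idP => [|/fR]; first by apply: contraTneq => ->; rewrite unitr0.
have [t [m [Ut t_gen t_m mr]]] := IH (quo_local locR f_surj f_ker).
have [t' ft] := f_surj t; exists t', m.
have fr := quo_rad locR f_surj f_ker.
split; rewrite -?fr ?rmorphB ?rmorphXn ?rmorph1 ?rmorph_nat ?ft //.
  by rewrite -(quo_unit locR f_surj f_ker) ft.
move=> u; rewrite -(quo_unit locR f_surj f_ker) => /t_gen[i ui].
by exists i; rewrite -fr rmorphB rmorphXn ft.
Qed.

Lemma cyc_map_id_unipotent (R : finComUnitRingType) (K : {set R}) :
    strongly_pure K -> local_ring R -> unit_subgroup K ->
    {in K, forall k, k - 1 \in rad R} ->
  forall s, s 0 = 0 -> s 1 = 1 -> cyc_map K s -> forall x, s x = x.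
Proof.
elim=> {R K} [R K fR _ _ _ K1 s s0 _ sK x | R K S f nfR pK f_surj f_ker spS IH].
  have [k /K1/(field_rad fR)/eqP] := sK 0 x.
  by rewrite subr_eq0 => /eqP-> ; rewrite s0 mulr1 !subr0.
move=> locR gK KU s s0 s1 sK.
have [s' fs s'K] := quo_cyc_map f_surj sK.
have s'id : forall y, s' y = y.
  apply: IH => //; first exact: (quo_local locR f_surj f_ker).
  - exact: (quo_unit_subgroup locR f_surj f_ker).
  - move=> _ /imsetP[k Kk ->]; rewrite -(rmorph1 f) -rmorphB.
    by rewrite (quo_rad locR f_surj f_ker) KU.
  - by rewrite -(rmorph0 f) -fs s0.
  - by rewrite -(rmorph1 f) -fs s1.
have sI x : s x - x \in I0 R by rewrite -f_ker rmorphB fs s'id subrr.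
pose V := [set v in I0 R | 1 + v \in K].
have [K1 KM KV] := gK.
have sqI v w : v \in I0 R -> w \in I0 R -> v * w = 0.
  by move=> /I0_rad vr; apply: rad_I0.
have V0 : 0 \in V by rewrite inE I00 addr0.
(* Products in [I0 R] vanish, so the quotient of [1 + v] by [1 + w] is [1 + (v - w)]. *)
have VB : {in V &, forall v w, v - w \in V}.
  move=> v w /setIdP[vI vK] /setIdP[wI wK]; rewrite inE I0B //=.
  have [Uw wVK] := KV _ wK; have := KM _ _ vK wVK; congr (_ \in K).
  apply: (mulIr Uw); rewrite mulrVK //.
  transitivity (1 + v + (v * w - w * w)); last by ring.
  by rewrite !sqI // subrr addr0.
have V_pure w : (forall r, r * w \in V) -> w = 0.
  by move=> wV; apply: (pure_principal pK) => r; have /setIdP[] := wV r.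
have [t [m [Ut t_gen t_m mr]]] :=
  strongly_pure_residue_gen (SP_step nfR pK f_surj f_ker spS) locR.
(* At unit distance the slope of [s x - x] is [k - 1], where [k] is the slope of [s]. *)
have dV : slopes_in V [ffun x => s x - x].
  split=> [x | x y Uxy]; rewrite !ffunE //.
  have [k Kk sxy] := sK x y.
  have e1 : (y - x)^-1 * (s y - y - (s x - x)) = k - 1.
    apply: (mulrI Uxy); rewrite mulVKr // mulrBr mulr1 -sxy; ring.
  rewrite e1 inE [1 + _]addrC subrK Kk andbT -e1.
  exact/I0M/I0B.
have /affineP dA := slopes_in_affine locR V0 VB V_pure Ut t_gen t_m mr dV.
move=> x; have := dA x; rewrite !ffunE s0 s1 !subrr mulr0 addr0 => /eqP.
by rewrite subr_eq0 => /eqP.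
Qed.

Lemma strongly_pure_meet_radical (R : finComUnitRingType) (K : {set R}) :
    strongly_pure K -> local_ring R -> unit_subgroup K ->
    (forall r : R, exists n : nat, r - n%:R \in rad R) ->
  {in K, forall k, k - 1 \in rad R -> k = 1}.
Proof.
elim=> {R K} [R K fR _ _ _ _ k _ /(field_rad fR)/eqP | R K S f _ pK f_surj f_ker _ IH].
  by rewrite subr_eq0 => /eqP.
move=> locR gK natR k Kk kr; have [K1 KM KV] := gK.
have fr := quo_rad locR f_surj f_ker.
have fk1 : f k = 1.
  apply: IH; rewrite ?imset_f //; first exact: (quo_local locR f_surj f_ker).
  - exact: (quo_unit_subgroup locR f_surj f_ker).
  - move=> y; have [x <-] := f_surj y; have [n xn] := natR x; exists n.
    by rewrite -(rmorph_nat f) -rmorphB fr.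
  - by rewrite -(rmorph1 f) -rmorphB fr.
have wI : k - 1 \in I0 R by rewrite -f_ker rmorphB fk1 rmorph1 subrr.
apply/eqP; rewrite -subr_eq0; apply/eqP; apply: (pure_principal pK) => r.
have [n rn] := natR r; rewrite (eq_mul_I0 rn wI).
(* The square of [k - 1] is 0, so powers of [k] are linear in the exponent; with every scalar a
   natural number modulo the radical, they fill [1 + R (k - 1)]. *)
suff -> : 1 + n%:R * (k - 1) = k ^+ n by elim: n {rn} => [|n] //; rewrite exprS; apply: KM.
elim: n {rn} => [|n IHn]; first by rewrite mul0r addr0.
have k2 : (k - 1) * (k - 1) = 0 by apply: rad_I0 => //; apply: I0_rad.
rewrite exprS -IHn -natr1.
transitivity (k * (1 + n%:R * (k - 1)) - n%:R * ((k - 1) * (k - 1))).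
  by ring.
by rewrite k2; ring.
Qed.

(** * The additive group of the residue field *)

Section ResidueGroup.
Variable R : finComUnitRingType.
Hypothesis locR : local_ring R.

Lemma rad_group_set : group_set (rad R).
Proof.
apply/group_setP; split; first exact: rad0.
by move=> x y; rewrite FinRing.zmodMgE; apply: radD.
Qed.

Let H := Group rad_group_set.

Let normH x : x \in 'N(H)%g.
Proof.
have /subsetP := sub_abelian_norm (FinRing.zmod_abelian [set: R]%G) (subsetT H).
by apply; rewrite inE.
Qed.

Lemma card_residue : #|([set: R] / H)%g| = resq R.
Proof.
rewrite card_quotient; last by apply/subsetP=> x _; apply: normH.
by rewrite -divgS ?subsetT // cardsT.
Qed.

Lemma resq_rad : (resq R)%:R \in rad R.
Proof.
apply: (@coset_idr _ H); first exact: normH.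
rewrite -card_residue -[_%:R]FinRing.zmodXgE morphX ?normH //.
by rewrite expg_cardG // mem_quotient // inE.
Qed.

Lemma resq_gt0 : (0 < resq R)%N.
Proof. by rewrite -card_residue cardG_gt0. Qed.

(** The class of 1 is nontrivial, so it generates a group of prime order. *)
Lemma prime_residue_nat : prime (resq R) ->
  forall r : R, exists n : nat, r - n%:R \in rad R.
Proof.
rewrite -card_residue => q_pr r; set x := coset H (1%R : R).
have Qx y : coset H y \in ([set: R] / H)%g by rewrite mem_quotient ?inE.
have x1 : #[x]%g != 1%N.
  rewrite order_eq1; apply/negP => /eqP x1.
  by have := coset_idr (normH (1%R : R)) x1; rewrite [_ \in _]radE unitr1.
have xQ : <[x]>%g = ([set: R] / H)%g.
  apply/eqP; rewrite eqEcard cycle_subG Qx /=.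
  have /primeP[_ /(_ _ (order_dvdG (Qx (1%R : R))))] := q_pr.
  by rewrite -/x (negPf x1) /= => /eqP <-.
have := Qx r; rewrite -xQ => /cycleP[n rn]; exists n.
apply: (@coset_idr _ H); first exact: normH.
rewrite -FinRing.zmodMgE -FinRing.zmodVgE morphM ?morphV ?normH ?groupV //=.
by rewrite -[n%:R]FinRing.zmodXgE morphX ?normH // -/x -rn mulgV.
Qed.

(** With q the residue order, the cofactor of [x - 1] in [x^(q-1) - 1] is congruent to q - 1, a unit
    because q is radical. *)
Lemma root1_rad_eq1 (x : R) : x ^+ (resq R).-1 = 1 -> x - 1 \in rad R -> x = 1.
Proof.
move=> xq xr; have := subrX1 x (resq R).-1; rewrite xq subrr => /esym.
set S := \sum_(i < _) _ => xS.
have Um : (resq R).-1%:R \is a @GRing.unit R.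
  by apply: pred_unit => //; rewrite prednK ?resq_gt0 ?resq_rad.
have Sr : S - (resq R).-1%:R \in rad R.
  rewrite -[X in X%:R]card_ord -sumr_const -sumrB.
  apply: (big_ind (fun y => y \in rad R)) => [||i _].
  - exact: rad0.
  - exact: radD.
  - by rewrite -(expr1n R i); apply: rad_exp_sub.
have US : S \is a GRing.unit by rewrite -(subrK (resq R).-1%:R S) addrC unitDrad.
have /eqP : x - 1 = 0 by apply: (mulIr US); rewrite xS mul0r.
by rewrite subr_eq0 => /eqP.
Qed.

End ResidueGroup.

(** * Normalisation of automorphisms, and the three cases *)

Lemma unitval_subgroup (R : finComUnitRingType) (K : {group {unit R}}) :
  unit_subgroup (unitval K).
Proof.
split=> [|_ _ /imsetP[k Kk ->] /imsetP[k' Kk' ->]|_ /imsetP[k Kk ->]].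
- by apply/imsetP; exists 1%g.
- by apply/imsetP; exists (k * k')%g; rewrite ?groupM.
- by split; [apply: valP | apply/imsetP; exists k^-1%g; rewrite ?groupV].
Qed.

(** If [k - k'] is radical then so is [k / k' - 1], so a trivial intersection with [1 + rad R] makes
    [K] injective modulo the radical. *)
Lemma cyc_map_id_radical (R : finComUnitRingType) (K : {set R}) :
    local_ring R -> ~ is_field R -> unit_subgroup K ->
    {in K, forall k, k - 1 \in rad R -> k = 1} ->
  forall s, s 0 = 0 -> s 1 = 1 -> cyc_map K s -> forall x, s x = x.
Proof.
move=> locR nfR [K1 KM KV] KU s; apply: cyc_map_id_inj => // k k' Kk Kk' kk'.
have [Uk' Kk'V] := KV _ Kk'; apply: (mulIr (x := k'^-1)); rewrite ?unitrV // mulrV //.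
by apply: KU; rewrite ?KM // -(mulrV Uk') -mulrBl radMr.
Qed.

Lemma AutCyc_sub_AGL1 (R : finComUnitRingType) (K : {group {unit R}}) :
    (forall s, s 0 = 0 -> s 1 = 1 -> cyc_map (unitval K) s -> forall x, s x = x) ->
  AutCyc K \subset AGL1 R.
Proof.
move=> Kid; apply/subsetP=> s; rewrite !inE => sAut.
have sK x y : exists2 k, k \in K & s y - s x = (y - x) * val k.
  (* Since 1 lies in [K], the pair [(x, y)] belongs to the relation indexed by [y - x]. *)
  have /forallP/(_ (y - x))/forallP/(_ x)/forallP/(_ y)/eqP sxy := sAut.
  have : y - x \in rK K (y - x) by apply/imsetP; exists 1%g; rewrite ?mulr1.
  by rewrite sxy => /imsetP[k Kk e1]; exists k.
have [a Ka] := sK 0 1; rewrite subr0 mul1r => sa.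
have Ua : val a \is a GRing.unit := valP a.
apply/existsP; exists a; apply/existsP; exists (s 0); apply/forallP=> x.
(* Subtracting [s 0] and dividing by the slope [a] from 0 to 1 normalises [s]; slopes stay in [K]
   because [a] does. *)
have := Kid (fun y => (s y - s 0) / val a).
rewrite subrr mul0r sa divrr // => /(_ erefl erefl).
move=> /(_ _ x) => sid; apply/eqP; rewrite -{2}sid; first by rewrite mulrC divrK // subrK.
move=> {sid}x y; have [k Kk e1] := sK x y; exists (val (k * a^-1)%g).
  by apply/imsetP; exists (k * a^-1)%g; rewrite ?groupM ?groupV.
rewrite -mulrBl (_ : _ - _ = s y - s x); last by ring.
by rewrite e1 -mulrA.
Qed.

Theorem theorem6p5 (R : finComUnitRingType) (K : {group {unit R}}) :
  local_ring R -> ~ is_field R ->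
  ((exists T : {group {unit R}}, [/\ cyclic T, #|T| = (resq R).-1 & K \subset T])
   \/ (strongly_pure (unitval K) /\ K \subset Uset R)
   \/ (strongly_pure (unitval K) /\ prime (resq R))) ->
  AutCyc K \subset AGL1 R.
Proof.
move=> locR nfR hK; apply: AutCyc_sub_AGL1.
have gK := unitval_subgroup K.
case: hK => [[T [_ cardT KT]] | [[spK KU] | [spK q_pr]]].
- apply: cyc_map_id_radical => // _ /imsetP[k Kk ->]; apply: root1_rad_eq1 => //.
  have := expg_cardG (subsetP KT k Kk); rewrite cardT => /(congr1 val).
  by rewrite FinRing.val_unitX.
- apply: cyc_map_id_unipotent => // _ /imsetP[k Kk ->].
  by have := subsetP KU k Kk; rewrite inE.
- apply: cyc_map_id_radical => //; apply: strongly_pure_meet_radical => //.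
  exact: prime_residue_nat.
Qed.
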